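(* Let $\rho\in(0,1]$ and $\alpha\in(0,1]$. Let $\Phi_{\alpha,\rho}(\xi,t)=\Gamma(\rho,\xi^2t^\alpha/2)/\Gamma(\rho)$, $\xi\in\mathbb{R}$, $t\ge0$, be the one-dimensional characteristic function $\mathbb{E}e^{i\xi B_{\alpha,\rho}(t)}$ of the $\Gamma$-grey Brownian motion $B_{\alpha,\rho}$, and let $e_\rho^z:=z^{\rho-1}E_{\rho,\rho}(z^\rho)$ be the $\rho$-exponential function. Then $\Phi_{\alpha,\rho}$ satisfies the integral equation $$\Phi_{\alpha,\rho}(\xi,t)=1-\frac{\alpha\xi^2}{2}\int_0^t e^{-\frac{\xi^2}{2}(t^\alpha-s^\alpha)}\,e_\rho^{\frac{\xi^2}{2}(t^\alpha-s^\alpha)}\,s^{\alpha-1}\,\Phi_{\alpha,\rho}(\xi,s)\,ds,\qquad t\ge0,\ \xi\in\mathbb{R}$$ (for $\xi=0$ the second term on the right-hand side is understood to be $0$).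
   Context: $\Gamma(\rho,x):=\int_x^{+\infty}e^{-w}w^{\rho-1}\,dw$ is the upper incomplete gamma function, and $E_{\rho,\rho}(x):=\sum_{j=0}^\infty x^j/\Gamma(\rho j+\rho)$ is the two-parameter Mittag-Leffler function. The process $B_{\alpha,\rho}$ is the time-changed Brownian motion $B(Y_\rho(t^\alpha))$, where $B$ is a standard Brownian motion independent of a process $Y_\rho$ with $\mathbb{E}e^{-\eta Y_\rho(t)}=\Gamma(\rho,\eta t)/\Gamma(\rho)$, so that its one-dimensional characteristic function is the $\Phi_{\alpha,\rho}$ given in the claim. *)

(* Defs.v *)
From HB Require Import structures.
From mathcomp Require Import all_boot all_order all_algebra.
From mathcomp Require Import all_classical all_reals all_analysis.
Import Order.TTheory GRing.Theory Num.Theory.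
Import numFieldNormedType.Exports.

Set Implicit Arguments.
Unset Strict Implicit.
Unset Printing Implicit Defensive.

Local Open Scope classical_set_scope.
Local Open Scope ring_scope.

(* Only evaluated at x >= 0 and rho > 0, where the integral is finite. *)
Definition upper_gamma {R : realType} (rho x : R) : R :=
  \int[@lebesgue_measure R]_(w in `]x, +oo[) (expR (- w) * w `^ (rho - 1)).

Definition Gamma {R : realType} (rho : R) : R := upper_gamma rho 0.

Definition mittag_leffler {R : realType} (a b x : R) : R :=
  limn (series (fun j : nat => x ^+ j / Gamma (a * j%:R + b))).

(* e_rho^z for z > 0.  This is not an exponential power of a base e_rho. *)
Definition rho_exp {R : realType} (rho z : R) : R :=
  z `^ (rho - 1) * mittag_leffler rho rho (z `^ rho).

(* The one-dimensional characteristic function of the Gamma-grey Brownian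
   motion: E exp(i xi B(Y(t^alpha))) = E exp(- (xi^2 / 2) Y(t^alpha)), and the
   Laplace transform of Y(t) at eta is Gamma(rho, eta t) / Gamma(rho). *)
Definition grey_charfun {R : realType} (alpha rho xi t : R) : R :=
  upper_gamma rho (xi ^+ 2 * t `^ alpha / 2) / Gamma rho.

(* The argument of expR and rho_exp is xi^2 / 2 * (t^alpha - s^alpha), which is
   positive for 0 < s < t and xi != 0. *)
Definition grey_integrand {R : realType} (alpha rho xi t s : R) : R :=
  let z := xi ^+ 2 / 2 * (t `^ alpha - s `^ alpha) in
  expR (- z) * rho_exp rho z * s `^ (alpha - 1) * grey_charfun alpha rho xi s.

(* Main.v *)
(** Put [c = xi^2 / 2] and [T = c t^alpha]. The substitution [u = c s^alpha]
    turns the right-hand side into [1 - (k * phi) (T)], where [phi] is the tail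
    of the Gamma(rho) law and [k z = exp (- z) e_rho^z]. Termwise,
    [k = \sum_(n >= 1) g_(n rho)] with [g_a] the density of the Gamma(a) law:
    [k] is the renewal density of the Gamma(rho) law. With [F_a] the
    distribution function of the Gamma(a) law, [g_a * g_b = g_(a + b)] gives
    [g_a * phi = F_a - F_(a + rho)], and the series telescopes to
    [F_rho (T) - lim F_(n rho) (T) = F_rho (T) = 1 - phi (T)]. *)

Require Import Defs.
From HB Require Import structures.
From mathcomp Require Import all_boot all_order all_algebra.
From mathcomp Require Import ring lra.
From mathcomp Require Import all_classical all_reals all_analysis.
From mathcomp Require Import measurable_realfun.
Import Order.TTheory GRing.Theory Num.Theory.
Import numFieldNormedType.Exports.

Local Open Scope classical_set_scope.
Local Open Scope ring_scope.

(** * Change of variables for the Lebesgue integral *)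

(** The kernel [k] is known only as an infinite sum and may blow up at z = 0, and s^(alpha - 1) may
    blow up at s = 0. The computation therefore runs in extended-real integrals of nonnegative
    measurable functions, where Tonelli, monotone convergence and substitution need no
    integrability; finiteness is read off at the end from F_rho (T) <= 1. Both limits rest on
    [Gamma_ge]: up to a factor independent of a, Gamma(a) is at least M^a. With M = 2z it makes the
    Mittag-Leffler series converge, with M = 2T it makes F_(n rho) (T) vanish; the factor 2 leaves
    the geometric ratio 2^(-rho) < 1. *)

Section change_of_variables.
Context {R : realType}.
Local Notation mu := (@lebesgue_measure R).
Variables Psi psi : R -> R.
Hypothesis mPsi : measurable_fun [set: R] Psi.
Hypothesis mpsi : measurable_fun [set: R] psi.
Hypothesis psi_ge0 : forall s, 0 <= psi s.
Hypothesis itv_image : forall x y, x <= y ->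
  (\int[mu]_(s in Psi @^-1` `]x, y]) (psi s)%:E = (y - x)%:E)%E.

(** The image under [Psi] of the measure with density [psi]. By [itv_image] it agrees with Lebesgue
    measure on half-open intervals, which determines it; no monotonicity or smoothness of [Psi] is
    asked for. *)
Let nu (A : set (measurableTypeR R)) : \bar R :=
  (\int[mu]_(s in Psi @^-1` A) (psi s)%:E)%E.

Let mpre (A : set (measurableTypeR R)) : measurable A -> measurable (Psi @^-1` A).
Proof. by move=> mA; rewrite -[_ @^-1` _]setTI; exact: mPsi. Qed.

Let nu0 : nu set0 = 0%E.
Proof. by rewrite /nu preimage_set0 integral_set0. Qed.

Let nu_ge0 A : (0 <= nu A)%E.
Proof. by apply: integral_ge0 => x _; rewrite lee_fin. Qed.

Let nu_sigma_additive : semi_sigma_additive nu.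
Proof.
move=> F mF tF mUF; rewrite /nu preimage_bigcup ge0_integral_bigcup//.
- apply: is_cvg_ereal_nneg_natsum_cond => n _ _.
  by apply: integral_ge0 => x _; rewrite lee_fin.
- by move=> k; exact: mpre.
- apply/measurable_EFinP; apply: measurable_funTS; exact: mpsi.
- by move=> x _; rewrite lee_fin.
- apply/trivIsetP => i j _ _ ij; rewrite -preimage_setI.
  by move/trivIsetP : tF => -> //; rewrite preimage_set0.
Qed.

HB.instance Definition _ := isMeasure.Build _ _ _ nu
  nu0 nu_ge0 nu_sigma_additive.

Let nuE (A : set (measurableTypeR R)) : measurable A -> mu A = nu A.
Proof.
apply: lebesgue_measure_unique => _ [[a b]] _ <-; rewrite /= lebesgue_measure_itv/=.
have [ab|ba] := ltP a b.
  by rewrite lte_fin ab /nu itv_image ?ltW// EFinB.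
rewrite lte_fin ltNge ba/= -nu0; congr nu.
by apply/esym/eqP; rewrite set_itv_ge// bnd_simp -leNgt.
Qed.

Import HBNNSimple.

(** For an indicator this is [nuE], and simple functions follow by linearity. The increasing
    approximations [f_] stay increasing after composition with [Psi], so monotone convergence
    applies on both sides. *)
Lemma ge0_change_of_variables (f : R -> \bar R) :
  measurable_fun [set: R] f -> (forall x, 0 <= f x)%E ->
  (\int[mu]_x f x = \int[mu]_s (f (Psi s) * (psi s)%:E))%E.
Proof.
move=> mf f0.
pose f_ := nnsfun_approx measurableT mf.
have ndf y m n : (m <= n)%N -> f_ m y <= f_ n y.
  by move=> mn; have /lefP/(_ y) := nd_nnsfun_approx measurableT mf mn.
have mfk n r : measurable (f_ n @^-1` [set r]).
  by rewrite -[_ @^-1` _]setTI; exact: (measurable_funPT (f_ n)).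
have mfP n : measurable_fun [set: R] (f_ n \o Psi).
  exact: (measurableT_comp (measurable_funPT (f_ n)) mPsi).
transitivity (limn (fun n => \int[mu]_x (f_ n x)%:E))%E.
  rewrite -monotone_convergence//.
  - apply: eq_integral => y _; apply/esym/cvg_lim => //.
    by apply: cvg_nnsfun_approx=> // *; apply: f0; rewrite inE.
  - by move=> n; apply/measurable_EFinP; exact: (measurable_funPT (f_ n)).
  - by move=> n y _; rewrite lee_fin.
  - by move=> y _ m n mn; rewrite lee_fin; exact: ndf.
transitivity (limn (fun n => \int[mu]_s (f_ n (Psi s) * psi s)%:E))%E; last first.
  rewrite -monotone_convergence//; last 3 first.
  - move=> n; apply/measurable_EFinP/measurable_funM; [exact: mfP|exact: mpsi].
  - by move=> n y _; rewrite lee_fin mulr_ge0.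
  - move=> y _ m n mn; by rewrite lee_fin ler_wpM2r// ndf.
  apply: eq_integral => y _; apply/cvg_lim => //.
  under eq_fun do rewrite EFinM.
  apply: cvgeZr => //.
  by apply: cvg_nnsfun_approx=> // *; apply: f0; rewrite inE.
congr (limn _); apply/funext => n.
transitivity (\sum_(k \in range (f_ n))
    \int[mu]_x (k * \1_(f_ n @^-1` [set k]) x)%:E)%E.
  rewrite -ge0_integral_fsum//.
  - by apply: eq_integral => x _; rewrite fsumEFin// -fimfunE.
  - move=> r; apply/measurable_EFinP/measurable_funM => //.
    exact: (measurable_indic (mfk n r)).
  - by move=> r x _; rewrite EFinM nnfun_muleindic_ge0.
transitivity (\sum_(k \in range (f_ n))
    \int[mu]_x (k * \1_(f_ n @^-1` [set k]) (Psi x) * psi x)%:E)%E.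
  apply: eq_fsbigr => r rf.
  have r0 : 0 <= r by move: rf; rewrite inE => -[x _ <-].
  under eq_integral do rewrite EFinM.
  under [in RHS]eq_integral do rewrite -mulrA EFinM.
  have mfr := mfk n r.
  rewrite !ge0_integralZl//; last 3 first.
  - apply/measurable_EFinP/measurable_funM => //.
    exact: measurableT_comp mPsi.
  - by move=> x _; rewrite lee_fin mulr_ge0.
  - by apply/measurable_EFinP; exact: (measurable_indic (mfk n r)).
  congr (_ * _)%E; transitivity (nu (f_ n @^-1` [set r])).
    by rewrite integral_indic// setIT; exact: nuE.
  rewrite /nu [LHS]integral_mkcond.
  apply: eq_integral => x _; rewrite patchE indicE.
  have -> : (x \in Psi @^-1` (f_ n @^-1` [set r])) = (Psi x \in f_ n @^-1` [set r]).
    by apply/idP/idP; rewrite !inE.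
  by case: (Psi x \in _); rewrite ?mul1r ?mul0r.
rewrite -ge0_integral_fsum//.
- apply: eq_integral => x _; rewrite fsumEFin//.
  by rewrite fsbig_finite// -mulr_suml -fsbig_finite// -fimfunE.
- move=> r; apply/measurable_EFinP/measurable_funM => //; apply/measurable_funM => //.
  exact: measurableT_comp mPsi.
- by move=> r x _; rewrite lee_fin mulr_ge0// -lee_fin EFinM nnfun_muleindic_ge0.
Qed.

End change_of_variables.

(** * Reflections, and integrals of powers up to the singularity at 0 *)

Section substitutions.
Context {R : realType}.
Local Notation mu := (@lebesgue_measure R).

Lemma ge0_integral_reflect (T : R) (f : R -> \bar R) :
  measurable_fun [set: R] f -> (forall x, 0 <= f x)%E ->
  (\int[mu]_x f (T - x)%R = \int[mu]_x f x)%E.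
Proof.
move=> mf f0.
rewrite [RHS](@ge0_change_of_variables _ (fun s => T - s) (fun=> 1))//.
- by apply: eq_integral => x _; rewrite mule1.
- exact: measurable_funB.
- move=> x y xy.
  rewrite (_ : _ @^-1` _ = `[T - y, T - x[%classic); last first.
    by apply/seteqP; split => s /=; rewrite !in_itv/= => /andP[? ?];
      apply/andP; split; lra.
  rewrite integral_cst//= mul1e lebesgue_measure_itv/= lte_fin ltrD2l ltrN2.
  have [xy'|yx] := ltP x y; first by rewrite -EFinB; congr EFin; ring.
  by congr EFin; lra.
Qed.

Lemma powR_continuous_pos (a x : R) : 0 < x -> {for x, continuous (fun s : R => s `^ a)}.
Proof.
move=> x0; apply/differentiable_continuous/derivable1_diffP.
by apply: derivable_powR; rewrite in_itv/= x0.
Qed.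

Lemma integral_powR_deriv (c a p q : R) : 0 < p -> p < q ->
  (\int[mu]_(s in `]p, q]) (c * (a * s `^ (a - 1)))%:E =
   (c * q `^ a - c * p `^ a)%:E)%E.
Proof.
move=> p0 pq.
rewrite integral_itv_obnd_cbnd; last first.
  apply/measurable_EFinP/measurable_funTS.
  by do 2 apply: measurable_funM => //; exact: measurable_powR.
rewrite (@continuous_FTC2 _ (fun s => c * (a * s `^ (a - 1))) (fun s => c * s `^ a)) ?EFinB//.
- apply: continuous_in_subspaceT => x; rewrite inE/= in_itv/= => /andP[px _].
  have x0 : 0 < x by exact: lt_le_trans px.
  by apply: cvgM; [exact: cvg_cst|apply: cvgM; [exact: cvg_cst|]];
    exact: powR_continuous_pos.
- have cF x : 0 < x -> {for x, continuous (fun s : R => c * s `^ a)}.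
    by move=> x0; apply: cvgM; [exact: cvg_cst|exact: powR_continuous_pos].
  split.
  + move=> x; rewrite in_itv/= => /andP[px _].
    apply: derivableM => //; apply: derivable_powR.
    by rewrite in_itv/= andbT (lt_trans p0).
  + by apply: cvg_at_right_filter; exact: cF.
  + by apply: cvg_at_left_filter; apply: cF; exact: lt_trans pq.
- move=> x; rewrite in_itv/= => /andP[px _].
  have x0 : 0 < x by exact: lt_trans px.
  rewrite derive1Ml; last by apply: derivable_powR; rewrite in_itv/= andbT.
  by rewrite powR_derive1// in_itv/= andbT.
Qed.

(** For a < 1 the integrand is unbounded at 0, so the fundamental theorem is applied on intervals
    that exhaust []0, q]], and the boundary term at the left end tends to 0. *)
Lemma integral_powR_deriv0 (c a q : R) : 0 <= c -> 0 < a -> 0 < q ->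
  (\int[mu]_(s in `]0%R, q]) (c * (a * s `^ (a - 1)))%:E = (c * q `^ a)%:E)%E.
Proof.
move=> c0 a0 q0.
(* With [n.+2] the left end is strictly below [q] already for n = 0, as [integral_powR_deriv]
   requires. *)
pose E n : set R := `](q / n.+2%:R), q]%classic.
have qn n : 0 < q / n.+2%:R by rewrite divr_gt0.
have UE : \bigcup_n E n = `]0, q]%classic.
  apply/seteqP; split => [x [n _]|x]; rewrite /E/= !in_itv/= => /andP[lx xq].
    by rewrite xq (lt_trans (qn n)).
  have [n nx] : exists n : nat, q / x < n%:R.
    by exists (Num.truncn (q / x)).+1; exact: truncnS_gt.
  exists n => //; rewrite /= in_itv/= xq andbT.
  rewrite ltr_pdivrMr// mulrC -ltr_pdivrMr// (lt_le_trans nx)// ler_nat.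
  by rewrite (leq_trans (leqnSn n)).
have mf (D : set R) : measurable_fun D (fun s : R => (c * (a * s `^ (a - 1)))%:E).
  apply/measurable_EFinP/measurable_funTS.
  by do 2 apply: measurable_funM => //; exact: measurable_powR.
have : (\int[mu]_(s in E n) (c * (a * s `^ (a - 1)))%:E @[n --> \oo] -->
    \int[mu]_(s in `]0%R, q]) (c * (a * s `^ (a - 1)))%:E)%E.
  rewrite -UE; apply: ge0_nondecreasing_set_cvg_integral => //.
  - apply/nondecreasing_seqP => n; apply/subsetPset => x.
    rewrite /E/= !in_itv/= => /andP[lx ->]; rewrite andbT.
    by rewrite (le_lt_trans _ lx)// ler_pM2l// lef_pV2 ?posrE// ler_nat.
  - by move=> n; exact: measurable_itv.
  - by move=> n; exact: mf.
  - by move=> n x _; rewrite lee_fin mulr_ge0// mulr_ge0 ?powR_ge0// ltW.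
have -> : (fun n => \int[mu]_(s in E n) (c * (a * s `^ (a - 1)))%:E)%E =
    (fun n => (c * q `^ a - c * (q / n.+2%:R) `^ a)%:E).
  apply/funext => n; rewrite integral_powR_deriv//.
  by rewrite ltr_pdivrMr// ltr_pMr// ltr1n.
move=> /cvg_lim <-//; apply/cvg_lim => //.
apply/cvg_EFin; first by near=> n.
rewrite -[X in _ --> X]subr0; apply: cvgB; first exact: cvg_cst.
rewrite -[X in _ --> X](mulr0 c); apply: cvgM; first exact: cvg_cst.
have := @powR_cvg0 R a a0.
move/cvg_at_rightP; apply; split => //.
rewrite -(mulr0 q); apply: cvgM; first exact: cvg_cst.
have := @cvg_harmonic R; rewrite -(cvg_shiftS (@harmonic R)); apply.
Unshelve. all: by end_near. Qed.

End substitutions.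

(** * The substitution u = c s^a on the half-line *)

Section power_substitution.
Context {R : realType}.
Local Notation mu := (@lebesgue_measure R).

(* The map [s |-> c s^a] extended by the identity to the negative half-line, so
   that it carries a density to Lebesgue measure on the whole line. *)
Let powF (c a s : R) : R := if 0 < s then c * s `^ a else s.
Let powf (c a s : R) : R := if 0 < s then c * (a * s `^ (a - 1)) else 1.

Let mpowF c a : measurable_fun [set: R] (powF c a).
Proof.
apply: measurable_fun_ifT => //; first exact: measurable_fun_ltr.
by apply: measurable_funM => //; exact: measurable_powR.
Qed.

Let mpowf c a : measurable_fun [set: R] (powf c a).
Proof.
apply: measurable_fun_ifT => //; first exact: measurable_fun_ltr.
by do 2 apply: measurable_funM => //; exact: measurable_powR.
Qed.

Let powf_ge0 c a s : 0 < c -> 0 < a -> 0 <= powf c a s.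
Proof.
move=> c0 a0; rewrite /powf; case: ifP => // s0.
by rewrite !mulr_ge0// ?powR_ge0// ltW.
Qed.

(** [powF] is an increasing bijection of the line that fixes 0, so preimages of intervals are
    intervals. Its density has a different form on each side of 0, hence the cases according to the
    position of 0. *)
Let powF_image (c a : R) (c0 : 0 < c) (a0 : 0 < a) (x y : R) : x <= y ->
  (\int[mu]_(s in powF c a @^-1` `]x, y]) (powf c a s)%:E = (y - x)%:E)%E.
Proof.
move=> xy.
(* The inverse of s -> c s^a on the half-line. After [clearbody] only the comparison and sign facts
   below are used. *)
pose q z := (z / c) `^ a^-1.
have qK z : 0 <= z -> c * q z `^ a = z.
  move=> z0; rewrite -powRrM mulVf ?gt_eqF// powRr1 ?divr_ge0// ?(ltW c0)//.
  by rewrite mulrCA divff ?gt_eqF// mulr1.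
have q_lt z s : 0 <= z -> 0 < s -> (z < c * s `^ a) = (q z < s).
  move=> z0 s0; rewrite -{1}(qK _ z0) ltr_pM2l//.
  apply/idP/idP; last first.
    by move=> h; rewrite gt0_ltr_powR// ?nnegrE ?powR_ge0// ltW.
  by apply: contraTT; rewrite -!leNgt => h; rewrite ge0_ler_powR// ?nnegrE ?powR_ge0// ltW.
have q_ge z s : 0 <= z -> 0 < s -> (c * s `^ a <= z) = (s <= q z).
  by move=> z0 s0; rewrite leNgt q_lt// -leNgt.
have q_gt0 z : 0 < z -> 0 < q z by move=> z0; rewrite powR_gt0// divr_gt0.
have q_ge0 z : 0 <= q z by exact: powR_ge0.
have q00 : q 0 = 0 by rewrite /q mul0r powR0// invr_eq0 gt_eqF.
clearbody q.
have mf D : measurable_fun D (EFin \o powf c a).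
  by apply/measurable_EFinP; apply: measurable_funTS; exact: mpowf.
have powF_gt0 s : 0 < s -> 0 < c * s `^ a by move=> s0; rewrite mulr_gt0// powR_gt0.
have pos p r : 0 <= p ->
    (\int[mu]_(s in `]p, r]) (powf c a s)%:E =
     \int[mu]_(s in `]p, r]) (c * (a * s `^ (a - 1)))%:E)%E.
  move=> p0; apply: eq_integral => s; rewrite inE/= in_itv/= => /andP[ps _].
  by rewrite /powf (le_lt_trans p0 ps).
have neg p r : p <= r -> r <= 0 ->
    (\int[mu]_(s in `]p, r]) (powf c a s)%:E = (r - p)%:E)%E.
  move=> pr r0; transitivity (\int[mu]_(s in `]p, r]) (cst 1%E s))%E.
    apply: eq_integral => s; rewrite inE/= in_itv/= => /andP[_ sr].
    by rewrite /powf ltNge (le_trans sr r0).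
  rewrite integral_cst//= mul1e lebesgue_measure_itv/= lte_fin.
  have [pr'|rp] := ltP p r; first by rewrite EFinB.
  by congr EFin; lra.
have [x0|x0] := leP 0 x.
  have -> : powF c a @^-1` `]x, y] = `](q x), (q y)]%classic.
    have y0 := le_trans x0 xy.
    apply/seteqP; split => s /=; rewrite !in_itv/= /powF.
      case: ifPn => s0; first by rewrite q_lt// q_ge.
      by rewrite -leNgt in s0 => /andP[xs _]; move: (lt_le_trans xs s0); rewrite ltNge x0.
    move=> /andP[qs sq].
    have s0 : 0 < s by rewrite (le_lt_trans _ qs).
    by rewrite s0 q_lt// q_ge// qs sq.
  rewrite pos//.
  have [->|xNy] := eqVneq x y.
    by rewrite set_itv_ge ?integral_set0 ?subrr// bnd_simp ltxx.
  have {xNy}xy' : x < y by rewrite lt_neqAle xNy.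
  have qxy : q x < q y.
    have y0 := le_lt_trans x0 xy'.
    by rewrite -q_lt ?q_gt0// qK// ltW.
  (* An interval starting at 0 touches the possible singularity of the density and needs the
     limiting version of the formula. *)
  have [x00|x00] := eqVneq x 0.
    rewrite x00 q00 in qxy *.
    by rewrite integral_powR_deriv0 ?(ltW c0)// qK ?subr0// -x00 ltW.
  have qx0 : 0 < q x by rewrite q_gt0// lt_def x00.
  by rewrite (integral_powR_deriv _ _ _ _ qx0 qxy) (qK y (le_trans x0 xy)) (qK x x0).
have [y0|y0] := leP y 0.
  have -> : powF c a @^-1` `]x, y] = `]x, y]%classic.
    apply/seteqP; split => s /=; rewrite !in_itv/= /powF.
      case: ifPn => s0 //.
      by move=> /andP[_ sy]; have := lt_le_trans (powF_gt0 _ s0) (le_trans sy y0); rewrite ltxx.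
    by move=> /andP[xs sy]; rewrite (ltNge 0 s) (le_trans sy y0)/= xs sy.
  exact: neg.
have -> : powF c a @^-1` `]x, y] = `]x, 0]%classic `|` `]0, (q y)]%classic.
  apply/seteqP; split => s /=; rewrite !in_itv/= /powF.
    case: ifPn => s0; first by rewrite q_ge ?(ltW y0)// => /andP[_ ?]; right.
    by rewrite -leNgt in s0 => /andP[xs _]; left; rewrite xs.
  case=> /andP[xs sy].
    by rewrite (ltNge 0 s) sy/= xs/= (le_trans sy)// ltW.
  by rewrite xs q_ge ?(ltW y0)// sy (lt_trans x0)// powF_gt0.
rewrite ge0_integral_setU//=; last 3 first.
- exact: mf.
- by move=> s _; rewrite lee_fin powf_ge0.
- apply/disj_setPS => s /= []; rewrite !in_itv/= => /andP[_ s0] /andP[s1 _].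
  by move: (lt_le_trans s1 s0); rewrite ltxx.
rewrite neg ?(ltW x0)// pos// integral_powR_deriv0 ?q_gt0 ?(ltW c0)// qK ?(ltW y0)//.
by rewrite -EFinD; congr EFin; ring.
Qed.

(** [powF] preserves positivity and nonpositivity, so restricting [f] to the positive half-line
    erases the auxiliary identity branch. *)
Lemma ge0_integral_power_substitution (c a : R) (f : R -> \bar R) :
  0 < c -> 0 < a -> measurable_fun [set: R] f -> (forall x, 0 <= f x)%E ->
  (\int[mu]_(u in `]0%R, +oo[) f u =
   \int[mu]_(s in `]0%R, +oo[) (f (c * s `^ a)%R * (c * (a * s `^ (a - 1)))%:E))%E.
Proof.
move=> c0 a0 mf f0.
rewrite [LHS]integral_mkcond [RHS]integral_mkcond.
rewrite (@ge0_change_of_variables _ (powF c a) (powf c a))//.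
- apply: eq_integral => s _; rewrite !patchE /powF /powf.
  rewrite !mem_setE !in_itv/= !andbT.
  case s0 : (0 < s); last by rewrite s0 mul0e.
  by rewrite mulr_gt0// powR_gt0.
- by move=> s; exact: powf_ge0.
- exact: powF_image.
- by apply/(measurable_restrictT f) => //; exact: measurable_funTS.
- by move=> x; apply: erestrict_ge0.
Qed.

Lemma ge0_integral_scale (c : R) (f : R -> \bar R) :
  0 < c -> measurable_fun [set: R] f -> (forall x, 0 <= f x)%E ->
  (\int[mu]_(u in `]0%R, +oo[) f u =
   \int[mu]_(s in `]0%R, +oo[) (f (c * s)%R * c%:E))%E.
Proof.
move=> c0 mf f0; rewrite (@ge0_integral_power_substitution c 1)//.
apply: eq_integral => s; rewrite inE/= in_itv/= andbT => s0.
by rewrite powRr1 ?ltW// subrr powRr0 !mulr1.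
Qed.

End power_substitution.

(** * Gamma densities *)

Section gamma_density.
Context {R : realType}.
Local Notation mu := (@lebesgue_measure R).

Lemma integral_powR_itv (a T : R) : 0 < a -> 0 < T ->
  (\int[mu]_(s in `]0%R, T]) (s `^ (a - 1))%:E = (T `^ a / a)%:E)%E.
Proof.
move=> a0 T0; rewrite -(mulrC a^-1) -integral_powR_deriv0// ?invr_ge0 ?ltW//.
by apply: eq_integral => s _; rewrite mulrA mulVf ?mul1r// gt_eqF.
Qed.

(** Extended by 0 to the whole line, so that convolutions are integrals without bounds. *)
Definition gamma_fun (a x : R) : R :=
  if 0 < x then expR (- x) * x `^ (a - 1) else 0.

Lemma gamma_fun_ge0 (a x : R) : 0 <= gamma_fun a x.
Proof. by rewrite /gamma_fun; case: ifP => // _; rewrite mulr_ge0 ?expR_ge0 ?powR_ge0. Qed.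

Lemma measurable_gamma_fun (a : R) : measurable_fun [set: R] (gamma_fun a).
Proof.
apply: measurable_fun_ifT => //; first exact: measurable_fun_ltr.
apply: measurable_funM; last exact: measurable_powR.
by apply: measurableT_comp => //; exact: measurableT_comp.
Qed.

(** Raise y <= exp y with y = x / (2a) to the power a. The scale 2a spends only half of the decay of
    exp (- x). *)
Lemma powR_le_expR (a x : R) : 0 < a -> 0 <= x ->
  x `^ a <= (2 * a) `^ a * expR (x / 2).
Proof.
move=> a0 x0; have a20 : 0 < 2 * a by rewrite mulr_gt0.
have -> : expR (x / 2) = expR (x / (2 * a)) `^ a.
  by rewrite -expRM; congr expR; field; rewrite gt_eqF.
rewrite -powRM ?expR_ge0 ?(ltW a20)//.
apply: ge0_ler_powR => //; rewrite ?nnegrE ?mulr_ge0 ?expR_ge0 ?(ltW a0) ?(ltW a20)//.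
by rewrite -ler_pdivrMl// mulrC (le_trans _ (expR_ge1Dx _))// lerDr ler01.
Qed.

(** The singularity at 0 is dominated by x^(a - 1) on []0, 1]], the tail by a multiple of the
    exponential density of rate 1/2. *)
Lemma integral_gamma_fun_lty (a : R) : 0 < a ->
  (\int[mu]_x (gamma_fun a x)%:E < +oo)%E.
Proof.
(* The constant of [powR_le_expR], times 2 to undo the factor 1/2 in the exponential density. *)
move=> a0; pose C := 2 * (2 * a) `^ a.
have C0 : 0 <= C by rewrite mulr_ge0// powR_ge0.
pose h1 : R -> R := (fun s : R => s `^ (a - 1)) \_ `]0, 1].
have mh1 : measurable_fun [set: R] h1.
  by apply/(measurable_restrictT (fun s : R => s `^ (a - 1))) => //; apply: measurable_funTS; exact: measurable_powR.
have h10 x : 0 <= h1 x by rewrite /h1 patchE; case: ifP => // _; exact: powR_ge0.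
pose h2 : R -> R := exponential_pdf 2^-1.
have h20 x : 0 <= h2 x by exact: exponential_pdf_ge0.
have mh2 : measurable_fun [set: R] h2 by exact: measurable_exponential_pdf.
have half0 : 0 < 2^-1 :> R by rewrite invr_gt0.
apply: (@le_lt_trans _ _ (\int[mu]_x ((h1 x)%:E + C%:E * (h2 x)%:E))%E).
  apply: ge0_le_integral => //.
  - by move=> x _; rewrite lee_fin gamma_fun_ge0.
  - by apply/measurable_EFinP; exact: measurable_gamma_fun.
  - by apply/measurable_EFinP; apply: measurable_funD => //; exact: measurable_funM.
  - move=> x _; rewrite -EFinM -EFinD lee_fin /gamma_fun.
    case: ifPn => x0; last by rewrite addr_ge0// mulr_ge0.
    have [x1|x1] := leP x 1.
      apply: ler_wpDr; first by rewrite mulr_ge0.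
      rewrite /h1 patchE mem_setE in_itv/= x0 x1.
      by rewrite ler_piMl ?powR_ge0// expR_le1 lerNl oppr0 ltW.
    apply: ler_wpDl => //; rewrite /h2 (exponential_pdfE _ (ltW x0)).
    apply: (@le_trans _ _ (expR (- x) * x `^ a)).
      rewrite ler_pM2l ?expR_gt0// ler_powR ?(ltW x1)//.
      by rewrite gerBl.
    apply: (@le_trans _ _ (expR (- x) * ((2 * a) `^ a * expR (x / 2)))).
      by rewrite ler_pM2l ?expR_gt0// powR_le_expR// ltW.
    rewrite le_eqVlt; apply/orP; left; apply/eqP.
    rewrite mulrCA -expRD /C (_ : - x + x / 2 = - 2^-1 * x); last by lra.
    by field.
rewrite ge0_integralD//; last 4 first.
- by move=> x _; rewrite lee_fin.
- exact/measurable_EFinP.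
- by move=> x _; rewrite mule_ge0 ?lee_fin.
- by apply/measurable_EFinP; exact: measurable_funM.
rewrite ge0_integralZl//; last 2 first.
- exact/measurable_EFinP.
- by move=> x _; rewrite lee_fin.
rewrite integral_exponential_pdf// mule1 lte_add_pinfty ?ltry//.
rewrite (_ : \int[mu]_x (h1 x)%:E = \int[mu]_(x in `]0%R, 1%R]) (x `^ (a - 1))%:E)%E.
  by rewrite integral_powR_itv ?ltry.
rewrite [RHS]integral_mkcond; apply: eq_integral => x _.
by rewrite /h1 !patchE; case: ifP.
Qed.

(** [Gamma] is the [fine] of an extended integral; the finiteness bound excludes the default
    value. *)
Lemma integral_gamma_fun (a : R) : 0 < a ->
  (\int[mu]_x (gamma_fun a x)%:E = (Gamma a)%:E)%E.
Proof.
move=> a0; rewrite /Gamma /upper_gamma /Rintegral fineK.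
  rewrite [RHS]integral_mkcond; apply: eq_integral => x _.
  by rewrite patchE mem_setE in_itv/= andbT /gamma_fun; case: ifP.
rewrite ge0_fin_numE.
  rewrite integral_mkcond (le_lt_trans _ (integral_gamma_fun_lty _ a0))//.
  rewrite le_eqVlt; apply/orP; left; apply/eqP; apply: eq_integral => x _.
  by rewrite patchE mem_setE in_itv/= andbT /gamma_fun; case: ifP.
by apply: integral_ge0 => x _; rewrite lee_fin mulr_ge0 ?expR_ge0 ?powR_ge0.
Qed.

(* From the part of the integral over [M, M + 1]: [Gamma a] outgrows every
   geometric sequence [M `^ a]. *)
Lemma Gamma_ge (a M : R) : 0 < a -> 0 < M ->
  expR (- (M + 1)) / (M + 1) * M `^ a <= Gamma a.
Proof.
move=> a0 M0; have M1 : 0 < M + 1 by rewrite addr_gt0.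
rewrite -lee_fin -integral_gamma_fun//.
set K := _ * _; have K0 : 0 <= K.
  by rewrite mulr_ge0 ?powR_ge0// divr_ge0 ?expR_ge0// ltW.
apply: (@le_trans _ _ (\int[mu]_(x in `]M, (M + 1)%R]) (cst K%:E x))%E).
  rewrite integral_cst//= lebesgue_measure_itv/= lte_fin ltrDl ltr01.
  by rewrite -EFinB addrAC subrr add0r mule1.
rewrite [leLHS]integral_mkcond; apply: ge0_le_integral => //.
- by move=> x _; apply: erestrict_ge0.
- by apply/(measurable_restrictT (cst K%:E)) => //; exact: measurable_cst.
- by apply/measurable_EFinP; exact: measurable_gamma_fun.
move=> x _; rewrite patchE mem_setE in_itv/=.
case: ifPn => [/andP[Mx xM]|_]; last by rewrite lee_fin gamma_fun_ge0.
have x0 := lt_trans M0 Mx.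
(* Writing x^(a - 1) as x^a / x avoids a case distinction on the sign of a - 1. *)
rewrite lee_fin /gamma_fun x0 powRB; last by rewrite (gt_eqF x0) implybT.
rewrite (powRr1 (ltW x0)) /K mulrAC -!mulrA ler_pM ?expR_ge0//.
- by rewrite divr_ge0 ?powR_ge0// ltW.
- by rewrite ler_expR lerN2.
- apply: ler_pM; rewrite ?powR_ge0 ?invr_ge0 ?(ltW M1)//.
    by rewrite ge0_ler_powR ?nnegrE ?(ltW a0) ?(ltW M0) ?(ltW x0) ?(ltW Mx).
  by rewrite lef_pV2 ?posrE.
Qed.

Lemma Gamma_gt0 (a : R) : 0 < a -> 0 < Gamma a.
Proof.
move=> a0; apply: lt_le_trans (Gamma_ge a 1 a0 ltr01).
by rewrite mulr_gt0 ?powR_gt0// divr_gt0 ?expR_gt0.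
Qed.

Definition gamma_pdf (a x : R) : R := gamma_fun a x / Gamma a.

Lemma gamma_pdf_ge0 (a x : R) : 0 < a -> 0 <= gamma_pdf a x.
Proof. by move=> a0; rewrite divr_ge0 ?gamma_fun_ge0// ltW ?Gamma_gt0. Qed.

Lemma measurable_gamma_pdf (a : R) : measurable_fun [set: R] (gamma_pdf a).
Proof. by apply: measurable_funM => //; exact: measurable_gamma_fun. Qed.

Lemma integral_gamma_pdf (a : R) : 0 < a -> (\int[mu]_x (gamma_pdf a x)%:E = 1)%E.
Proof.
move=> a0; under eq_integral do rewrite EFinM.
rewrite ge0_integralZr//.
- by rewrite integral_gamma_fun// -EFinM divff// gt_eqF// Gamma_gt0.
- by apply/measurable_EFinP; exact: measurable_gamma_fun.
- by move=> x _; rewrite lee_fin gamma_fun_ge0.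
- by rewrite lee_fin invr_ge0 ltW// Gamma_gt0.
Qed.

End gamma_density.

(** * The convolution semigroup of Gamma densities *)

Section gamma_convolution.
Context {R : realType}.
Local Notation mu := (@lebesgue_measure R).

(** A translation is the composite of two reflections. *)
Lemma ge0_integral_shift (w : R) (f : R -> \bar R) :
  measurable_fun [set: R] f -> (forall x, 0 <= f x)%E ->
  (\int[mu]_x f (x - w)%R = \int[mu]_x f x)%E.
Proof.
move=> mf f0.
have mfN : measurable_fun [set: R] (f \o -%R) by exact: measurableT_comp.
rewrite -(@ge0_integral_reflect _ 0 f)// -(@ge0_integral_reflect _ w (fun x => f (0 - x)))//.
  by apply: eq_integral => x _; congr f; ring.
by apply: measurableT_comp => //; exact: measurable_funB.
Qed.

Lemma ge0_integral_swap (f : R -> R -> R) :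
  measurable_fun [set: R * R] (fun z => f z.1 z.2) -> (forall x y, 0 <= f x y) ->
  (\int[mu]_x \int[mu]_y (f x y)%:E = \int[mu]_y \int[mu]_x (f x y)%:E)%E.
Proof.
move=> mf f0.
apply: (@fubini_tonelli _ _ _ _ R mu mu (fun z => (f z.1 z.2)%:E)).
  exact/measurable_EFinP.
by move=> z; rewrite lee_fin.
Qed.

Let beta_fun (a b v : R) : R :=
  if 0 < v then
    if v < 1 then (1 - v) `^ (a - 1) * v `^ (b - 1) else 0
  else 0.

Let mbeta_fun a b : measurable_fun [set: R] (beta_fun a b).
Proof.
apply: measurable_fun_ifT => //; first exact: measurable_fun_ltr.
apply: measurable_fun_ifT => //; first exact: measurable_fun_ltr.
apply: measurable_funM; last exact: measurable_powR.
apply: (measurableT_comp (@measurable_powR R (a - 1))).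
exact: measurable_funB.
Qed.

(* [C] is the Beta integral; it is never evaluated, because the convolution of two
   probability densities has total mass 1. *)
Lemma gamma_fun_conv (a b : R) : exists C : \bar R, (0 <= C)%E /\
  forall y, (\int[mu]_w (gamma_fun a (y - w) * gamma_fun b w)%:E =
             C * (gamma_fun (a + b) y)%:E)%E.
Proof.
have beta_ge0 v : 0 <= beta_fun a b v.
  by rewrite /beta_fun; case: ifP => // _; case: ifP => // _; rewrite mulr_ge0 ?powR_ge0.
exists (\int[mu]_(v in `]0%R, +oo[) (beta_fun a b v)%:E)%E; split.
  by apply: integral_ge0 => v _; rewrite lee_fin.
move=> y; have [y0|y0] := leP y 0.
  rewrite [gamma_fun (a + b) y]/gamma_fun ltNge y0/= mule0 integral0_eq// => w _.
  rewrite /gamma_fun; case: ifPn => yw; last by rewrite mul0r.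
  by case: ifPn => w0; [exfalso; move: yw w0 y0; lra|rewrite mulr0].
have mh : measurable_fun [set: R] (fun w => (gamma_fun a (y - w) * gamma_fun b w)%:E).
  apply/measurable_EFinP; apply: measurable_funM; last exact: measurable_gamma_fun.
  apply: measurableT_comp; first exact: measurable_gamma_fun.
  exact: measurable_funB.
transitivity (\int[mu]_(w in `]0%R, +oo[) (gamma_fun a (y - w) * gamma_fun b w)%:E)%E.
  rewrite [RHS]integral_mkcond; apply: eq_integral => w _.
  rewrite patchE mem_setE in_itv/= andbT; case: ifPn => // w0.
  by rewrite {2}/gamma_fun (negbTE w0) mulr0.
(* With w = y v the exponentials combine to exp (- y), and the powers of y, including the factor
   from the scaling, to y^(a + b - 1); what remains is the Beta integrand in v. *)
rewrite (@ge0_integral_scale _ y)//; last first.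
  by move=> w; rewrite lee_fin mulr_ge0 ?gamma_fun_ge0.
rewrite muleC -ge0_integralZl//=; last 3 first.
- by apply/measurable_EFinP/measurable_funTS; exact: mbeta_fun.
- by move=> v _; rewrite lee_fin.
- by rewrite lee_fin gamma_fun_ge0.
apply: eq_integral => v; rewrite inE/= in_itv/= andbT => v0.
rewrite -!EFinM; congr EFin; rewrite /gamma_fun /beta_fun v0 y0 mulr_gt0//=.
have -> : y - y * v = y * (1 - v) by ring.
rewrite pmulr_rgt0// subr_gt0.
case: ifPn => v1; last by rewrite !mul0r mulr0.
rewrite !powRM ?subr_ge0 ?(ltW y0) ?(ltW v0) ?(ltW v1)//.
have -> : y `^ (a + b - 1) = y * (y `^ (a - 1) * y `^ (b - 1)).
  rewrite -powRD ?(gt_eqF y0) ?implybT// -{2}(powRr1 (ltW y0)).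
  by rewrite -powRD ?(gt_eqF y0) ?implybT//; congr (_ `^ _); ring.
have -> : expR (- y) = expR (- (y * (1 - v))) * expR (- (y * v)).
  by rewrite -expRD; congr expR; ring.
ring.
Qed.

(** The normalizers will be Gamma values; only their positivity matters here. *)
Lemma gamma_fun_conv_scaled (a b ga gb gab : R) :
  0 < ga -> 0 < gb -> 0 < gab -> exists D : \bar R, (0 <= D)%E /\
  forall y, (\int[mu]_w (gamma_fun a (y - w) / ga * (gamma_fun b w / gb))%:E =
             D * (gamma_fun (a + b) y / gab)%:E)%E.
Proof.
move=> ga0 gb0 gab0; have [C [C0 Ch]] := gamma_fun_conv a b.
exists (C * (gab / (ga * gb))%:E)%E; split.
  by rewrite mule_ge0// lee_fin divr_ge0 ?mulr_ge0// ltW.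
move=> z; rewrite -muleA -EFinM.
have -> : gab / (ga * gb) * (gamma_fun (a + b) z / gab) =
    gamma_fun (a + b) z * (ga * gb)^-1.
  by field; rewrite !gt_eqF.
rewrite EFinM muleA -Ch -ge0_integralZr//; last 3 first.
- apply/measurable_EFinP; apply: measurable_funM; last exact: measurable_gamma_fun.
  apply: measurableT_comp; first exact: measurable_gamma_fun.
  exact: measurable_funB.
- by move=> w _; rewrite lee_fin mulr_ge0 ?gamma_fun_ge0.
- by rewrite lee_fin invr_ge0 mulr_ge0// ltW.
apply: eq_integral => w _; rewrite -EFinM; congr EFin.
by field; rewrite !gt_eqF.
Qed.

(** The constant [D] is found by integrating over y: one side gives [D], the other, by Tonelli and
    translation invariance, the product of two total masses 1. *)
Lemma gamma_pdf_conv (a b y : R) : 0 < a -> 0 < b ->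
  (\int[mu]_w (gamma_pdf a (y - w) * gamma_pdf b w)%:E =
   (gamma_pdf (a + b) y)%:E)%E.
Proof.
move=> a0 b0; have ab0 : 0 < a + b by rewrite addr_gt0.
have [D [D0 Dh]] := gamma_fun_conv_scaled a b _ _ _
  (Gamma_gt0 _ a0) (Gamma_gt0 _ b0) (Gamma_gt0 _ ab0).
rewrite -!/(gamma_pdf _ _) in Dh.
suff D1 : D = 1%E by rewrite Dh D1 mul1e.
have mpdf c : measurable_fun [set: R] (EFin \o gamma_pdf c).
  by apply/measurable_EFinP; exact: measurable_gamma_pdf.
transitivity (\int[mu]_y \int[mu]_w (gamma_pdf a (y - w) * gamma_pdf b w)%:E)%E.
  under eq_integral do rewrite Dh.
  rewrite ge0_integralZl ?integral_gamma_pdf ?mule1//; first exact: mpdf.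
  by move=> x _; rewrite lee_fin gamma_pdf_ge0.
rewrite (@ge0_integral_swap (fun y w => gamma_pdf a (y - w) * gamma_pdf b w)); last 2 first.
- apply: measurable_funM; apply: measurableT_comp => //.
  + exact: measurable_gamma_pdf.
  + exact: measurable_funB.
  + exact: measurable_gamma_pdf.
- by move=> x w; rewrite mulr_ge0 ?gamma_pdf_ge0.
transitivity (\int[mu]_w (gamma_pdf b w)%:E)%E; last exact: integral_gamma_pdf.
apply: eq_integral => w _; under eq_integral do rewrite EFinM.
rewrite ge0_integralZr//; last 3 first.
- apply/measurable_EFinP; apply: measurableT_comp; first exact: measurable_gamma_pdf.
  exact: measurable_funB.
- by move=> x _; rewrite lee_fin gamma_pdf_ge0.
- by rewrite lee_fin gamma_pdf_ge0.
rewrite (@ge0_integral_shift w (fun x => (gamma_pdf a x)%:E)).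
- by rewrite integral_gamma_pdf ?mul1e.
- exact: mpdf.
- by move=> x; rewrite lee_fin gamma_pdf_ge0.
Qed.

End gamma_convolution.

(** * The renewal equation of the Gamma law *)

Section gamma_renewal.
Context {R : realType}.
Local Notation mu := (@lebesgue_measure R).

(** The bound sits in the integrand and not in the domain, so that Tonelli applies over the whole
    plane and regions are compared pointwise. *)
Definition gamma_cdf (a T : R) : \bar R :=
  (\int[mu]_x (if x <= T then gamma_pdf a x else 0)%:E)%E.

Definition gamma_tail (a u : R) : \bar R :=
  (\int[mu]_x (if u < x then gamma_pdf a x else 0)%:E)%E.

Lemma gamma_cdf_ge0 (a T : R) : 0 < a -> (0 <= gamma_cdf a T)%E.
Proof.
by move=> a0; apply: integral_ge0 => x _; rewrite lee_fin; case: ifP => // _; exact: gamma_pdf_ge0.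
Qed.

Lemma gamma_tail_ge0 (a u : R) : 0 < a -> (0 <= gamma_tail a u)%E.
Proof.
by move=> a0; apply: integral_ge0 => x _; rewrite lee_fin; case: ifP => // _; exact: gamma_pdf_ge0.
Qed.

Lemma gamma_cdf_tail (a u : R) : 0 < a ->
  (gamma_cdf a u + gamma_tail a u = 1)%E.
Proof.
move=> a0; rewrite -(integral_gamma_pdf a a0) -ge0_integralD//.
- apply: eq_integral => x _; rewrite -EFinD.
  by case: (leP x u) => _; rewrite ?addr0 ?add0r.
- by move=> x _; rewrite lee_fin; case: ifP => // _; exact: gamma_pdf_ge0.
- apply/measurable_EFinP; apply: measurable_fun_ifT => //.
    exact: measurable_fun_ler.
  exact: measurable_gamma_pdf.
- by move=> x _; rewrite lee_fin; case: ifP => // _; exact: gamma_pdf_ge0.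
- apply/measurable_EFinP; apply: measurable_fun_ifT => //.
    exact: measurable_fun_ltr.
  exact: measurable_gamma_pdf.
Qed.

Lemma gamma_cdf_le1 (a T : R) : 0 < a -> (gamma_cdf a T <= 1)%E.
Proof. by move=> a0; rewrite -(gamma_cdf_tail a T a0) leeDl// gamma_tail_ge0. Qed.

Lemma gamma_tail_le1 (a T : R) : 0 < a -> (gamma_tail a T <= 1)%E.
Proof. by move=> a0; rewrite -(gamma_cdf_tail a T a0) leeDr// gamma_cdf_ge0. Qed.

(** For u >= 0 the cutoff of [gamma_fun] at 0 is invisible beyond [u]; finiteness is again needed
    for [fine]. *)
Lemma gamma_tailE (a u : R) : 0 < a -> 0 <= u ->
  gamma_tail a u = (upper_gamma a u / Gamma a)%:E.
Proof.
move=> a0 u0.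
have E : (\int[mu]_x (if (u < x)%R then gamma_fun a x else 0)%:E =
    \int[mu]_(w in `]u, +oo[) (expR (- w) * w `^ (a - 1))%:E)%E.
  rewrite [RHS]integral_mkcond; apply: eq_integral => x _.
  rewrite patchE mem_setE in_itv/= andbT; case: ifP => // ux.
  by rewrite /gamma_fun (le_lt_trans u0 ux).
have Ga0 := Gamma_gt0 _ a0.
rewrite /gamma_tail /gamma_pdf; move: (Gamma a) Ga0 => ga ga0.
have finE : (\int[mu]_(w in `]u, +oo[) (expR (- w) * w `^ (a - 1))%:E)%E \is a fin_num.
  rewrite -E ge0_fin_numE; last first.
    by apply: integral_ge0 => x _; rewrite lee_fin; case: ifP => // _; exact: gamma_fun_ge0.
  apply: le_lt_trans (integral_gamma_fun_lty a a0); apply: ge0_le_integral => //.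
  - by move=> x _; rewrite lee_fin; case: ifP => // _; exact: gamma_fun_ge0.
  - apply/measurable_EFinP; apply: measurable_fun_ifT => //.
      exact: measurable_fun_ltr.
    exact: measurable_gamma_fun.
  - by apply/measurable_EFinP; exact: measurable_gamma_fun.
  - by move=> x _; rewrite lee_fin; case: ifP => // _; exact: gamma_fun_ge0.
rewrite EFinM /upper_gamma /Rintegral fineK// -E -ge0_integralZr//.
- by apply: eq_integral => x _; rewrite -EFinM; case: ifP; rewrite ?mul0r.
- apply/measurable_EFinP; apply: measurable_fun_ifT => //.
    exact: measurable_fun_ltr.
  exact: measurable_gamma_fun.
- by move=> x _; rewrite lee_fin; case: ifP => // _; exact: gamma_fun_ge0.
- by rewrite lee_fin invr_ge0 ltW.
Qed.

Lemma measurable_gamma_tail (a : R) : 0 < a ->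
  measurable_fun [set: R] (gamma_tail a).
Proof.
move=> a0.
pose f (z : R * R) := (if z.1 < z.2 then gamma_pdf a z.2 else 0)%:E.
apply: (measurable_fun_fubini_tonelli_F (m2 := mu) f).
  apply/measurable_EFinP; apply: measurable_fun_ifT => //.
    exact: measurable_fun_ltr.
  by apply: measurableT_comp => //; exact: measurable_gamma_pdf.
by move=> z; rewrite lee_fin; case: ifP => // _; exact: gamma_pdf_ge0.
Qed.

(** For independent X and W with laws Gamma(a) and Gamma(r), the event X <= T splits into X <= T < X
    + W and X + W <= T; here u = T - X. The additive form avoids subtraction in the extended
    reals. *)
Lemma gamma_pdf_conv_tail (a r T : R) : 0 < a -> 0 < r ->
  (\int[mu]_u ((gamma_pdf a (T - u))%:E * (if (0 <= u)%R then gamma_tail r u else 0))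
   + gamma_cdf (a + r) T = gamma_cdf a T)%E.
Proof.
move=> a0 r0.
pose A u w := gamma_pdf a (T - u) *
  (if 0 <= u then if u < w then gamma_pdf r w else 0 else 0).
pose B u w := gamma_pdf a (T - u) * (if w <= u then gamma_pdf r w else 0).
have A0 u w : 0 <= A u w.
  rewrite mulr_ge0 ?gamma_pdf_ge0//; case: ifP => // _; case: ifP => // _.
  exact: gamma_pdf_ge0.
have B0 u w : 0 <= B u w.
  by rewrite mulr_ge0 ?gamma_pdf_ge0//; case: ifP => // _; exact: gamma_pdf_ge0.
have mTu : measurable_fun [set: R * R] (fun z : R * R => gamma_pdf a (T - z.1)).
  apply: (measurableT_comp (measurable_gamma_pdf a)).
  exact: measurable_funB.
have mpr : measurable_fun [set: R * R] (fun z : R * R => gamma_pdf r z.2).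
  by apply: (measurableT_comp (measurable_gamma_pdf r)).
have mA : measurable_fun [set: R * R] (fun z => A z.1 z.2).
  apply: (measurable_funM mTu); apply: measurable_fun_ifT.
  - exact: measurable_fun_ler.
  - apply: measurable_fun_ifT; [exact: measurable_fun_ltr|exact: mpr|].
    exact: measurable_cst.
  - exact: measurable_cst.
have mB : measurable_fun [set: R * R] (fun z => B z.1 z.2).
  apply: (measurable_funM mTu); apply: measurable_fun_ifT.
  - exact: measurable_fun_ler.
  - exact: mpr.
  - exact: measurable_cst.
(* Both terms on the left are double integrals of [g_a (T - u) g_r w], over
   [0 <= u < w] and over [w <= u]; together these regions make up [0 <= u]. *)
have -> : (\int[mu]_u ((gamma_pdf a (T - u))%:E *
      (if (0 <= u)%R then gamma_tail r u else 0)) =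
    \int[mu]_w \int[mu]_u (A u w)%:E)%E.
  rewrite -(ge0_integral_swap A)//; apply: eq_integral => u _.
  under eq_integral do rewrite /A EFinM.
  rewrite ge0_integralZl//; last 3 first.
  - apply/measurable_EFinP; case: (0 <= u) => //; apply: measurable_fun_ifT => //.
      exact: measurable_fun_ltr.
    exact: measurable_gamma_pdf.
  - move=> w _; rewrite lee_fin; case: ifP => // _; case: ifP => // _.
    exact: gamma_pdf_ge0.
  - by rewrite lee_fin gamma_pdf_ge0.
  by congr (_ * _)%E; case: (0 <= u); [|rewrite integral0_eq].
have -> : (gamma_cdf (a + r) T = \int[mu]_w \int[mu]_u (B u w)%:E)%E.
  pose B' y w := if y <= T then gamma_pdf a (y - w) * gamma_pdf r w else 0.
  have B'0 y w : 0 <= B' y w.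
    by rewrite /B'; case: ifP => // _; rewrite mulr_ge0 ?gamma_pdf_ge0.
  transitivity (\int[mu]_y \int[mu]_w (B' y w)%:E)%E.
    apply: eq_integral => y _; rewrite /B'; case: (y <= T); last by rewrite integral0_eq.
    by rewrite gamma_pdf_conv.
  have mB' : measurable_fun [set: R * R] (fun z => B' z.1 z.2).
    apply: measurable_fun_ifT; [exact: measurable_fun_ler| |exact: measurable_cst].
    apply: measurable_funM; last exact: mpr.
    apply: (measurableT_comp (measurable_gamma_pdf a)).
    exact: measurable_funB.
  rewrite (ge0_integral_swap B' mB' B'0); apply: eq_integral => w _.
  (* Setting y = T + w - u turns y - w into T - u, and the condition y <= T into w <= u. *)
  rewrite -(@ge0_integral_reflect _ (T + w) (fun y => (B' y w)%:E)).
  - apply: eq_integral => u _; rewrite /B /B'; congr EFin.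
    have -> : T + w - u - w = T - u by ring.
    have -> : (T + w - u <= T) = (w <= u) by apply/idP/idP; lra.
    by case: ifP; rewrite ?mulr0.
  - apply/measurable_EFinP; apply: measurable_fun_ifT => //.
      exact: measurable_fun_ler.
    apply: measurable_funM => //; apply: (measurableT_comp (measurable_gamma_pdf a)).
    exact: measurable_funB.
  - by move=> y; rewrite lee_fin.
rewrite -ge0_integralD//; last 4 first.
- by move=> w _; apply: integral_ge0 => u _; rewrite lee_fin.
- apply: (measurable_fun_fubini_tonelli_G (m1 := mu) (fun z : R * R => (A z.1 z.2)%:E)).
    exact/measurable_EFinP.
  by move=> z; rewrite lee_fin.
- by move=> w _; apply: integral_ge0 => u _; rewrite lee_fin.
- apply: (measurable_fun_fubini_tonelli_G (m1 := mu) (fun z : R * R => (B z.1 z.2)%:E)).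
    exact/measurable_EFinP.
  by move=> z; rewrite lee_fin.
transitivity (\int[mu]_w ((gamma_pdf r w)%:E * gamma_cdf a T))%E; last first.
  rewrite ge0_integralZr//.
  - by rewrite integral_gamma_pdf// mul1e.
  - by apply/measurable_EFinP; exact: measurable_gamma_pdf.
  - by move=> w _; rewrite lee_fin gamma_pdf_ge0.
  - exact: gamma_cdf_ge0.
apply: eq_integral => w _.
have msec (f : R -> R -> R) : measurable_fun [set: R * R] (fun z => f z.1 z.2) ->
    measurable_fun [set: R] (fun u => (f u w)%:E).
  move=> mf; apply/measurable_EFinP.
  apply: (measurableT_comp mf (g := fun u => (u, w))).
  exact: measurable_fun_pair.
rewrite -ge0_integralD//; last 4 first.
- by move=> u _; rewrite lee_fin.
- exact: msec.
- by move=> u _; rewrite lee_fin.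
- exact: msec.
rewrite /gamma_cdf -(@ge0_integral_reflect _ T (fun x => (if x <= T then _ else _)%:E)); last 2 first.
- apply/measurable_EFinP; apply: measurable_fun_ifT => //.
    exact: measurable_fun_ler.
  exact: measurable_gamma_pdf.
- by move=> x; rewrite lee_fin; case: ifP => // _; exact: gamma_pdf_ge0.
rewrite -ge0_integralZl//; last 3 first.
- apply/measurable_EFinP; apply: measurable_fun_ifT => //.
    by apply: measurable_fun_ler => //; exact: measurable_funB.
  apply: (measurableT_comp (measurable_gamma_pdf a)); exact: measurable_funB.
- by move=> x _; rewrite lee_fin; case: ifP => // _; exact: gamma_pdf_ge0.
- by rewrite lee_fin gamma_pdf_ge0.
apply: eq_integral => u _; rewrite -EFinD -EFinM; congr EFin; rewrite /A /B.
(* A negative [w] would let the region of [B] reach u < 0, but there the density in [w] vanishes. *)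
have [w0|w0] := leP w 0.
  have -> : gamma_pdf r w = 0 by rewrite /gamma_pdf /gamma_fun ltNge w0/= mul0r.
  by rewrite mul0r !if_same !mulr0 addr0.
have -> : (T - u <= T) = (0 <= u) by apply/idP/idP; lra.
move: (gamma_pdf a _) (gamma_pdf r w) => p q.
have [wu|uw] := leP w u.
  by rewrite (le_trans (ltW w0) wu) mulr0 add0r mulrC.
by case: (0 <= u); rewrite ?mulr0 addr0// mulrC.
Qed.

End gamma_renewal.

(** * Convergence of the Mittag-Leffler series and decay of F_(n rho) *)

Section gamma_renewal_series.
Context {R : realType}.
Local Notation mu := (@lebesgue_measure R).

Lemma powR_half_lt1 (r : R) : 0 < r -> 2^-1 `^ r < 1 :> R.
Proof.
move=> r0; rewrite -[ltRHS](powRr0 2^-1) /powR gt_eqF// ltr_expR.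
by rewrite ltr_nM2r// ln_lt0// invr_gt0 ltr0n/= invf_lt1// ltr1n.
Qed.

(** The term of index j in E_(r,r) carries Gamma(r j + r) and so matches the density of index r (j +
    1). Convergence has to be proved, since [limn] is a default value otherwise. *)
Lemma gamma_pdf_series (r z : R) : 0 < r -> 0 < z ->
  (\sum_(n <oo) (gamma_pdf (r * n.+1%:R) z)%:E = (expR (- z) * rho_exp r z)%:E)%E.
Proof.
move=> r0 z0.
pose u n := (z `^ r) ^+ n / Gamma (r * n%:R + r).
have a0 n : 0 < r * n%:R + r :> R by rewrite ltr_wpDl// mulr_ge0// ltW.
have uE n : gamma_pdf (r * n.+1%:R) z = expR (- z) * z `^ (r - 1) * u n.
  rewrite /gamma_pdf /gamma_fun z0 /u.
  have -> : r * n.+1%:R = r * n%:R + r by rewrite -natr1 mulrDr mulr1.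
  rewrite mulrA -(powR_mulrn n (powR_ge0 z r)) -powRrM -!mulrA.
  congr (_ * _); rewrite mulrA -powRD ?(gt_eqF z0) ?implybT//.
  by congr (_ `^ _ / _); ring.
have u0 n : 0 <= u n.
  by rewrite /u divr_ge0 ?exprn_ge0 ?powR_ge0// ltW// Gamma_gt0.
(* With this [M], [Gamma_ge] bounds the terms by a geometric sequence of ratio (z / M)^r =
   2^(-r). *)
pose M := 2 * z; have M0 : 0 < M by rewrite mulr_gt0.
pose k := expR (- (M + 1)) / (M + 1).
have k0 : 0 < k by rewrite divr_gt0 ?expR_gt0// addr_gt0.
pose q : R := 2^-1 `^ r.
have q1 : `|q| < 1.
  by rewrite ger0_norm ?powR_ge0// powR_half_lt1.
have cu : cvgn (series u).
  apply: (@series_le_cvg _ u (geometric (k * M `^ r)^-1 q)) => //.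
  - by move=> n; rewrite /= mulr_ge0// ?exprn_ge0 ?powR_ge0// invr_ge0 mulr_ge0 ?powR_ge0// ltW.
  - move=> n /=; rewrite /u ler_pdivrMr ?Gamma_gt0//.
    apply: le_trans (ler_wpM2l _ (Gamma_ge _ M (a0 n) M0)); last first.
      by rewrite mulr_ge0// ?exprn_ge0 ?powR_ge0// invr_ge0 mulr_ge0 ?powR_ge0// ltW.
    rewrite -/k powRD ?(gt_eqF M0) ?implybT// powRrM powR_mulrn ?powR_ge0//.
    have Mr0 : 0 < M `^ r by rewrite powR_gt0.
    have -> : z `^ r = q * M `^ r.
      by rewrite /q /M -powRM ?invr_ge0 ?(ltW M0)// mulrA mulVf ?mul1r.
    rewrite exprMn le_eqVlt; apply/orP; left; apply/eqP.
    by field; rewrite !gt_eqF.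
  - exact: is_cvg_geometric_series.
have -> : rho_exp r z = z `^ (r - 1) * limn (series u) by [].
apply/cvg_lim => //.
have -> : (fun n => \sum_(0 <= i < n) (gamma_pdf (r * i.+1%:R) z)%:E)%E =
    (fun n => (expR (- z) * z `^ (r - 1) * series u n)%:E).
  apply/funext => n; rewrite sumEFin /series/= mulr_sumr; congr EFin.
  by apply: eq_bigr => i _; exact: uE.
apply/cvg_EFin; first by near=> n.
by rewrite mulrA; apply: cvgM => //; exact: cvg_cst.
Unshelve. all: by end_near. Qed.

(** Bounding exp (- x) by 1 gives T^a / (a Gamma(a)). [Gamma_ge] at M = 2T then supplies the
    reciprocal of the leading factor, and (T / M)^a = 2^(-a). *)
Lemma gamma_cdf_le (a T : R) : 0 < a -> 0 < T ->
  (gamma_cdf a T <= (expR (2 * T + 1) * (2 * T + 1) / a * 2^-1 `^ a)%:E)%E.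
Proof.
move=> a0 T0; have Ga0 := Gamma_gt0 _ a0.
pose M := 2 * T; have M0 : 0 < M by rewrite mulr_gt0.
have GM := Gamma_ge a M a0 M0.
apply: (@le_trans _ _ ((T `^ a / a) / Gamma a)%:E).
  rewrite /gamma_cdf /gamma_pdf; move: (Gamma a) Ga0 {GM} => ga ga0.
  rewrite EFinM -integral_powR_itv// -ge0_integralZr//; last 3 first.
  - by apply/measurable_EFinP; apply: measurable_funTS; exact: measurable_powR.
  - by move=> x _; rewrite lee_fin powR_ge0.
  - by rewrite lee_fin invr_ge0 ltW.
  rewrite [leRHS]integral_mkcond; apply: ge0_le_integral => //.
  - by move=> x _; rewrite lee_fin; case: ifP => // _; rewrite divr_ge0 ?gamma_fun_ge0// ltW.
  - apply/measurable_EFinP; apply: measurable_fun_ifT => //.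
      exact: measurable_fun_ler.
    by apply: measurable_funM => //; exact: measurable_gamma_fun.
  - apply/(measurable_restrictT (fun x : R => (x `^ (a - 1))%:E * (ga^-1)%:E)%E) => //.
    apply/measurable_EFinP; apply: measurable_funTS.
    by apply: measurable_funM => //; exact: measurable_powR.
  - move=> x _; rewrite patchE mem_setE in_itv/= /gamma_fun.
    have [x0|x0] := ltP 0 x; last by rewrite mul0r; case: ifP.
    case: ifP => //= _; rewrite -EFinM lee_fin ler_pM2r ?invr_gt0//.
    by rewrite ler_piMl ?powR_ge0// expR_le1 lerNl oppr0 ltW.
rewrite lee_fin; move: (Gamma a) Ga0 GM => ga ga0 GM; rewrite -/M.
have M1 : 0 < M + 1 by rewrite addr_gt0.
have K0 : 0 < expR (M + 1) * (M + 1) / a * 2^-1 `^ a.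
  by rewrite !mulr_gt0 ?expR_gt0 ?powR_gt0 ?invr_gt0.
rewrite ler_pdivrMr// (le_trans _ (ler_wpM2l (ltW K0) GM))//.
have -> : T `^ a = 2^-1 `^ a * M `^ a.
  by rewrite -powRM ?invr_ge0 ?(ltW M0)// /M mulrA mulVf ?mul1r.
rewrite expRN le_eqVlt; apply/orP; left; apply/eqP.
by field; rewrite !gt_eqF ?expR_gt0.
Qed.

Lemma gamma_cdf_cvg0 (r T : R) : 0 < r -> 0 < T ->
  (gamma_cdf (r * n.+1%:R) T @[n --> \oo] --> 0)%E.
Proof.
move=> r0 T0.
pose K := expR (2 * T + 1) * (2 * T + 1) / r.
pose q : R := 2^-1 `^ r.
have q1 : `|q| < 1 by rewrite ger0_norm ?powR_ge0// powR_half_lt1.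
have rn0 n : 0 < r * n.+1%:R by rewrite mulr_gt0.
(* The factor 1 / (r (n + 1)) is bounded by 1 / r, and q^(n + 1) by q^n. *)
apply: (@squeeze_cvge _ _ _ _ (cst 0%E) _ (fun n => (geometric K q n)%:E)).
- apply: nearW => n; rewrite gamma_cdf_ge0//=.
  apply: le_trans (gamma_cdf_le _ _ (rn0 n) T0) _.
  rewrite lee_fin powRrM powR_mulrn ?powR_ge0// -/q.
  have T1 : 0 < 2 * T + 1 by rewrite addr_gt0 ?mulr_gt0.
  apply: ler_pM.
  + by rewrite !mulr_ge0 ?expR_ge0 ?invr_ge0 ?(ltW T1) ?(ltW (rn0 n)).
  + by rewrite exprn_ge0 ?powR_ge0.
  + rewrite ler_wpM2l//; first by rewrite mulr_ge0 ?expR_ge0 ?(ltW T1).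
    by rewrite lef_pV2 ?posrE// ler_peMr ?(ltW r0)// ler1n.
  + have q01 : 0 <= q <= 1 by rewrite powR_ge0 (ltW (powR_half_lt1 _ r0)).
    by case/andP: q01 => q0 q1'; rewrite exprS ler_piMl ?exprn_ge0.
- exact: cvg_cst.
- apply/cvg_EFin; first by near=> n.
  exact: cvg_geometric.
Unshelve. all: by end_near. Qed.

End gamma_renewal_series.

(** * The telescoping series *)

Section renewal_equation.
Context {R : realType}.
Local Notation mu := (@lebesgue_measure R).

(** Finiteness of [d] is what permits cancelling the remainder [d n] in the extended reals. *)
Lemma eseries_telescope (c d : nat -> \bar R) :
  (forall n, d n \is a fin_num) -> (forall n, (c n + d n.+1 = d n)%E) ->
  d n @[n --> \oo] --> 0%E -> (\sum_(n <oo) c n = d 0%N)%E.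
Proof.
move=> dfin cd d0.
have cS n : (\sum_(0 <= i < n) c i + d n = d 0%N)%E.
  elim: n => [|n IH]; first by rewrite big_geq// add0e.
  by rewrite big_nat_recr//= -addeA cd.
apply/cvg_lim => //.
have -> : (fun n => \sum_(0 <= i < n) c i)%E = (fun n => d 0%N - d n)%E.
  by apply/funext => n; rewrite -(cS n) addeK.
rewrite -[X in _ --> X]sube0; apply: cvgeB => //; last exact: cvg_cst.
by rewrite fin_num_adde_defr.
Qed.

(** Extended-real, hence defined and measurable on the whole line without a convergence proof;
    [gamma_pdf_series] identifies it for z > 0. *)
Definition gamma_renewal_density (r z : R) : \bar R :=
  (\sum_(n <oo) (gamma_pdf (r * n.+1%:R) z)%:E)%E.

Lemma gamma_renewal_density_ge0 (r z : R) : 0 < r ->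
  (0 <= gamma_renewal_density r z)%E.
Proof.
move=> r0; apply: nneseries_ge0 => n _ _.
by rewrite lee_fin gamma_pdf_ge0// mulr_gt0.
Qed.

Lemma gamma_renewal_density0 (r z : R) : z <= 0 -> gamma_renewal_density r z = 0%E.
Proof.
move=> z0; apply: eseries0 => n _ _.
by rewrite /gamma_pdf /gamma_fun ltNge z0/= mul0r.
Qed.

Lemma measurable_gamma_renewal_density (r : R) : 0 < r ->
  measurable_fun [set: R] (gamma_renewal_density r).
Proof.
move=> r0; apply: ge0_emeasurable_sum.
  by move=> n x _ _; rewrite lee_fin gamma_pdf_ge0// mulr_gt0.
by move=> n _; apply/measurable_EFinP; exact: measurable_gamma_pdf.
Qed.

Lemma gamma_renewal_equation (r T : R) : 0 < r -> 0 < T ->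
  (\int[mu]_u (gamma_renewal_density r (T - u) *
     (if (0 <= u)%R then gamma_tail r u else 0)) = gamma_cdf r T)%E.
Proof.
move=> r0 T0; have rn0 n : 0 < r * n.+1%:R by rewrite mulr_gt0.
pose g u : \bar R := (if (0 <= u)%R then gamma_tail r u else 0)%E.
have g0 u : (0 <= g u)%E by rewrite /g; case: ifP => // _; exact: gamma_tail_ge0.
have mg : measurable_fun [set: R] g.
  apply: measurable_fun_ifT; last exact: measurable_cst.
  - exact: measurable_fun_ler.
  - exact: measurable_gamma_tail.
pose c n := (\int[mu]_u ((gamma_pdf (r * n.+1%:R) (T - u))%:E * g u))%E.
transitivity (\sum_(n <oo) c n)%E.
  rewrite -integral_nneseries//; last 2 first.
  - move=> n; apply: emeasurable_funM => //.
    apply/measurable_EFinP; apply: (measurableT_comp (measurable_gamma_pdf _)).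
    exact: measurable_funB.
  - by move=> n u _; rewrite mule_ge0// lee_fin gamma_pdf_ge0.
  apply: eq_integral => u _; rewrite -/(g u).
  (* A finite factor can be moved through the series. *)
  have gfin : g u \is a fin_num.
    rewrite ge0_fin_numE//; apply: (@le_lt_trans _ _ 1%E); last exact: ltry.
    by rewrite /g; case: ifP => // _; rewrite ?lee01// gamma_tail_le1.
  rewrite -(fineK gfin) muleC -nneseriesZl//.
    by apply: eq_eseriesr => n _; rewrite muleC.
  by move=> n _; rewrite lee_fin gamma_pdf_ge0.
have cE n : (c n + gamma_cdf (r * n.+2%:R) T = gamma_cdf (r * n.+1%:R) T)%E.
  have -> : r * n.+2%:R = r * n.+1%:R + r by rewrite -[in LHS]natr1 mulrDr mulr1.
  exact: gamma_pdf_conv_tail.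
have d_fin n : gamma_cdf (r * n.+1%:R) T \is a fin_num.
  rewrite ge0_fin_numE ?gamma_cdf_ge0//; apply: (@le_lt_trans _ _ 1%E); last exact: ltry.
  exact: gamma_cdf_le1.
rewrite (eseries_telescope _ _ d_fin cE (gamma_cdf_cvg0 _ _ r0 T0)).
exact: (congr1 (gamma_cdf^~ T) (mulr1 r)).
Qed.

End renewal_equation.

(** * Return to the time variable s *)

Section grey_equation.
Context {R : realType}.
Local Notation mu := (@lebesgue_measure R).
Variables (alpha rho xi t : R).
Hypotheses (rho0 : 0 < rho) (alpha0 : 0 < alpha) (t0 : 0 < t) (xi0 : xi != 0).

Let c := xi ^+ 2 / 2.
Let T := c * t `^ alpha.

Let renewal_integrand (u : R) : \bar R :=
  (gamma_renewal_density rho (T - u) *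
   (if (0 <= u)%R then gamma_tail rho u else 0))%E.

(** The renewal integrand at u = c s^alpha, times the Jacobian. Measurability and integrability of
    [grey_integrand] are inherited from it and never derived from the Mittag-Leffler function
    itself. *)
Let substituted (s : R) : \bar R :=
  (renewal_integrand (c * s `^ alpha)%R *
   (c * (alpha * s `^ (alpha - 1)))%:E)%E.

Let c_gt0 : 0 < c.
Proof. by rewrite divr_gt0// exprn_even_gt0. Qed.

Let T_gt0 : 0 < T.
Proof. by rewrite mulr_gt0// powR_gt0. Qed.

Let cpowR_ge0 s : 0 <= c * s `^ alpha.
Proof. by apply: mulr_ge0; [exact: ltW|exact: powR_ge0]. Qed.

Lemma grey_charfunE (s : R) : 0 <= s ->
  (grey_charfun alpha rho xi s)%:E = gamma_tail rho (c * s `^ alpha).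
Proof.
move=> s0; rewrite gamma_tailE ?cpowR_ge0//.
by rewrite /grey_charfun /c mulrAC.
Qed.

Let renewal_integrand_ge0 u : (0 <= renewal_integrand u)%E.
Proof.
rewrite mule_ge0 ?gamma_renewal_density_ge0//.
by case: ifP => // _; exact: gamma_tail_ge0.
Qed.

Let measurable_renewal_integrand : measurable_fun [set: R] renewal_integrand.
Proof.
apply: emeasurable_funM.
  apply: (measurableT_comp (measurable_gamma_renewal_density _ rho0)).
  exact: measurable_funB.
apply: measurable_fun_ifT; last exact: measurable_cst.
- exact: measurable_fun_ler.
- exact: measurable_gamma_tail.
Qed.

Let substituted_in (s : R) : 0 < s < t ->
  substituted s = (alpha * xi ^+ 2 / 2 * grey_integrand alpha rho xi t s)%:E.
Proof.
move=> /andP[s0 st].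
have st' : s `^ alpha < t `^ alpha by rewrite gt0_ltr_powR// ?nnegrE ltW.
have z0 : 0 < c * (t `^ alpha - s `^ alpha) by rewrite mulr_gt0// subr_gt0.
rewrite /substituted /renewal_integrand cpowR_ge0.
rewrite -(grey_charfunE _ (ltW s0)) /T -mulrBr.
rewrite /gamma_renewal_density gamma_pdf_series// -!EFinM /grey_integrand -/c.
congr EFin; rewrite /c; move: (grey_charfun _ _ _ _) (rho_exp _ _) (expR _) => x y w.
by field.
Qed.

(** Here c s^alpha >= T, so the renewal density is taken at a nonpositive argument; this cuts the
    half-line integral off at [t]. *)
Let substituted_out (s : R) : t <= s -> substituted s = 0%E.
Proof.
move=> ts; rewrite /substituted /renewal_integrand gamma_renewal_density0 ?mul0e//.
rewrite subr_le0 ler_pM2l// ge0_ler_powR// ?nnegrE ?(ltW alpha0) ?(ltW t0)//.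
exact: le_trans (ltW t0) ts.
Qed.

Let measurable_substituted : measurable_fun [set: R] substituted.
Proof.
apply: emeasurable_funM.
  apply: (measurableT_comp measurable_renewal_integrand).
  by apply: measurable_funM => //; exact: measurable_powR.
apply/measurable_EFinP.
by do 2 apply: measurable_funM => //; exact: measurable_powR.
Qed.

Let integral_substituted :
  (\int[mu]_(s in `]0%R, t[) substituted s = gamma_cdf rho T)%E.
Proof.
rewrite -gamma_renewal_equation// -/(renewal_integrand _).
transitivity (\int[mu]_(u in `[0%R, +oo[) renewal_integrand u)%E; last first.
  rewrite [LHS]integral_mkcond; apply: eq_integral => u _.
  rewrite patchE mem_setE in_itv/= andbT /renewal_integrand.
  by case: (0 <= u); rewrite ?mule0.
rewrite -integral_itv_obnd_cbnd; last exact: measurable_funTS.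
rewrite (ge0_integral_power_substitution _ _ _ c_gt0 alpha0)//.
rewrite [LHS]integral_mkcond [RHS]integral_mkcond; apply: eq_integral => s _.
rewrite !patchE !mem_setE !in_itv/= andbT.
have [s0|s0] //= := ltP 0 s.
by have [st|ts] // := ltP s t; rewrite -/(substituted s) substituted_out.
Qed.

Let kE : alpha * xi ^+ 2 / 2 != 0.
Proof. by rewrite !mulf_neq0 ?expf_neq0// gt_eqF. Qed.

Let cdf_fin : gamma_cdf rho T \is a fin_num.
Proof.
rewrite ge0_fin_numE ?gamma_cdf_ge0//.
by apply: (@le_lt_trans _ _ 1%E); [exact: gamma_cdf_le1|exact: ltry].
Qed.

(** On []0, t[] the integrand is a constant multiple of [substituted], which is nonnegative with
    integral F_rho (T) <= 1. *)
Lemma integrable_grey_integrand :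
  mu.-integrable `]0, t[ (EFin \o grey_integrand alpha rho xi t).
Proof.
have isub : mu.-integrable `]0, t[ substituted.
  apply/integrableP; split; first exact: measurable_funTS.
  have -> : (\int[mu]_(s in `]0%R, t[) `|substituted s| =
      \int[mu]_(s in `]0%R, t[) substituted s)%E.
    apply: eq_integral => s _; rewrite gee0_abs// /substituted mule_ge0//.
    have a1 := powR_ge0 s (alpha - 1).
    by rewrite lee_fin mulr_ge0 ?(ltW c_gt0)// mulr_ge0// ltW.
  by rewrite integral_substituted -ge0_fin_numE ?gamma_cdf_ge0.
have iZ := @integrableZl _ _ _ mu _ (measurable_itv _) (alpha * xi ^+ 2 / 2)^-1 _ isub.
apply: eq_integrable iZ => //.
  move=> s; rewrite inE/= in_itv/= => sst.
  by rewrite substituted_in// -EFinM mulrA mulVf// mul1r.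
Qed.

Lemma grey_charfun_renewal :
  grey_charfun alpha rho xi t =
    1 - alpha * xi ^+ 2 / 2 * \int[mu]_(s in `]0, t[) grey_integrand alpha rho xi t s.
Proof.
rewrite -RintegralZl//; last exact: integrable_grey_integrand.
rewrite /Rintegral.
have -> : (\int[mu]_(s in `]0%R, t[)
    (alpha * xi ^+ 2 / 2 * grey_integrand alpha rho xi t s)%:E = gamma_cdf rho T)%E.
  rewrite -integral_substituted; apply: eq_integral => s.
  by rewrite inE/= in_itv/= => sst; rewrite substituted_in.
apply: EFin_inj; rewrite EFinB fineK// (grey_charfunE _ (ltW t0)) -/T.
by rewrite -(gamma_cdf_tail _ T rho0) addeAC subee ?add0e.
Qed.

End grey_equation.

(** The integrability clause guarantees that the real-valued integral in the equation is a genuine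
    one and not a default value. *)
Theorem theorem5p2 (R : realType) (rho alpha : R)
    (hrho : 0 < rho <= 1) (halpha : 0 < alpha <= 1)
    (xi t : R) (ht : 0 <= t) :
  (xi != 0 ->
     (@lebesgue_measure R).-integrable `]0, t[
       (EFin \o grey_integrand alpha rho xi t)) /\
  grey_charfun alpha rho xi t =
    1 - (if xi == 0 then 0 else
           alpha * xi ^+ 2 / 2 *
           \int[@lebesgue_measure R]_(s in `]0, t[)
             grey_integrand alpha rho xi t s).
Proof.
case/andP: hrho => rho0 _; case/andP: halpha => alpha0 _.
have charfun1 : xi ^+ 2 * t `^ alpha / 2 = 0 -> grey_charfun alpha rho xi t = 1.
  by rewrite /grey_charfun => ->; rewrite divff// gt_eqF// Gamma_gt0.
(* At t = 0 the domain of integration is empty and the characteristic function is Gamma(rho) /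
   Gamma(rho) = 1. *)
have [t0|t0] := leP t 0.
  have tE : t = 0 by apply/le_anti/andP.
  rewrite charfun1; last by rewrite tE powR0 ?gt_eqF// mulr0 mul0r.
  rewrite tE set_itv_ge ?bnd_simp ?ltxx//; split => [_|].
    exact: integrable_set0.
  by rewrite Rintegral_set0 mulr0 if_same subr0.
have [xiE|xi0] := eqVneq xi 0.
  by split => //; rewrite charfun1 ?subr0// xiE expr0n/= !mul0r.
split => [_|]; first exact: integrable_grey_integrand.
exact: grey_charfun_renewal.
Qed.
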